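(* The following hold. (i) $m(\partial_z)\star P_{\mathcal N}^\perp\subset P_B^\perp\subset P_{\mathcal N}^\perp$. In particular, if $K_{\mathcal N}=I_0$, then $P_{\mathcal N}^\perp=P_B^\perp$. (ii) $m(s)\in P_{\mathcal N}$ if and only if $m(\partial_z)\star P_{\mathcal N}^\perp=\{0\}$. (iii) If $P_{\mathcal N}=m(s)\cdot P_B$, then $m(\partial_z)\star P_{\mathcal N}^\perp=P_B^\perp$.
   Context: $\mathbb N=\{0,1,2,\dots\}$. $A$ is a $d\times n$ integer matrix of rank $d$ which is homogeneous: all its columns lie on one hyperplane of $\mathbb Q^d$ not passing through the origin. $L=\{u\in\mathbb Z^n: Au=0\}$. Each $u\in\mathbb Z^n$ is written uniquely as $u=u_+-u_-$ with $u_\pm\in\mathbb N^n$ of disjoint supports. $I_A=\langle\partial^u-\partial^{u'}: u,u'\in\mathbb N^n, Au=Au'\rangle\subset\mathbb C[\partial_1,\dots,\partial_n]$. For $v\in\mathbb C^n$, $u\in\mathbb N^n$: $[v]_u=\prod_j v_j(v_j-1)\cdots(v_j-u_j+1)$; $\mathrm{nsupp}(v)=\{j: v_j\in\mathbb Z_{<0}\}$. Fix $\beta\in\mathbb C^d$, a generic weight $w\in\mathbb R^n$ (in particular $\mathrm{in}_w(I_A)$ is monomial) and a fake exponent $v$ of the $A$-hypergeometric ideal $H_A(\beta)$ with respect to $w$, i.e. $Av=\beta$ and $[v]_{u_+}=0$ for all $u\in L$ with $u_+\cdot w>u_-\cdot w$. Write $I_u=\mathrm{nsupp}(v+u)$ for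 $u\in L$. Let $B=\{b^{(1)},\dots,b^{(h)}\}\subset L$ be linearly independent, also regarded as the $n\times h$ matrix with these columns; $\mathrm{supp}(B)$ is the set of indices of its nonzero rows. Assume $I_0\subset\mathrm{supp}(B)\cup I_u$ for all $u\in L$. $s=(s_1,\dots,s_h)^T$ are indeterminates, $(Bs)_j=\sum_k b_j^{(k)}s_k$, $(Bs)^J=\prod_{j\in J}(Bs)_j$. Let $\{\partial^{g_+^{(i)}}-\partial^{g_-^{(i)}}: i=1,\dots,M\}$ be the reduced Gröbner basis of $I_A$ with respect to $w$, $\partial^{g_+^{(i)}}\in\mathrm{in}_w(I_A)$; $C(w)=\sum_i\mathbb Ng^{(i)}$; $G^{(i)}=I_{-g^{(i)}}\setminus I_0$. Put $\mathrm{NS}_w(v)=\{I_u: u\in L,\text{ and every }u'\in L\text{ with }I_{u'}=I_u\text{ lies in }C(w)\}$, $\mathcal N=\{I\in\mathrm{NS}_w(v):\mathrm{supp}(B)\cup I=\mathrm{supp}(B)\cup I_0\}$, $\mathcal N^c=\{I_u:u\in L,\mathrm{supp}(B)\cup I_u=\mathrm{supp}(B)\cup I_0\}\setminus\mathcal N$, $K_{\mathcal N}=\bigcap_{I\in\mathcal N}I$, $m(s)=(Bs)^{I_0\setminus K_{\mathcal N}}$, $P_{\mathcal N}=\langle(Bs)^{(I\cup J)\setminus K_{\mathcal N}}:I\in\mathcal N,J\in\mathcal N^c\rangle$ and $P_B=\langle(Bs)^{G^{(i)}}:i=1,\dots,M\rangle$ in $\mathbb C[s]$. For a homogeneous ideal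 $P\subset\mathbb C[s]$, $P^\perp=\{q(\partial_s)\in\mathbb C[\partial_s]:(q(\partial_s)\bullet h(s))_{|s=0}=0\ \forall h\in P\}$, with $\mathbb C[\partial_s]=\mathbb C[\partial_{s_1},\dots,\partial_{s_h}]$. For $U(\partial_z)\in\mathbb C[\partial_{z_1},\dots,\partial_{z_h}]$ and $q(\partial_s)\in\mathbb C[\partial_s]$, $U(\partial_z)\star q(\partial_s):=(U(\partial_z)\bullet q(z))_{|z=\partial_s}\in\mathbb C[\partial_s]$; $m(\partial_z)$ is obtained from $m(s)$ by $s_k\mapsto\partial_{z_k}$. *)

(* Defs.v *)
From HB Require Import structures.
From mathcomp Require Import all_boot all_order all_algebra.
From mathcomp Require Export boolp classical_sets reals complex mpoly.

Set Implicit Arguments.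
Unset Strict Implicit.
Unset Printing Implicit Defensive.

Import Order.TTheory GRing.Theory Num.Theory.

Local Open Scope ring_scope.

Definition ideal_gen (T : comNzRingType) (S : set T) : set T :=
  [set p | exists (k : nat) (c f : 'I_k -> T),
     (forall i, S (f i)) /\ p = \sum_(i < k) c i * f i]%classic.

Definition homogeneous_mx d n (A : 'M[int]_(d, n)) : Prop :=
  exists (c : 'rV[rat]_d) (b : rat),
    [/\ c != 0, b != 0 &
        forall j, (c *m map_mx (intr : int -> rat) A) ord0 j = b].

Definition lattice d n (A : 'M[int]_(d, n)) : set 'cV[int]_n :=
  [set u | A *m u = 0]%classic.

(* [pos_part u] is u_+, and u_- = (- u)_+ is [pos_part (- u)]. *)
Definition pos_part n (u : 'cV[int]_n) : 'X_{1..n} :=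
  [multinom `|Num.max (u j ord0) 0|%N | j < n].

Definition mnm_col n (m : 'X_{1..n}) : 'cV[int]_n := \col_j (m j)%:Z.

Definition toric_ideal (K : comNzRingType) d n (A : 'M[int]_(d, n)) :
    set {mpoly K[n]} :=
  ideal_gen [set p : {mpoly K[n]} | exists m m' : 'X_{1..n},
    A *m mnm_col m = A *m mnm_col m' /\ p = 'X_[m] - 'X_[m']]%classic.
Arguments toric_ideal K {d n} A _.

Definition wdeg (R : numDomainType) n (w : 'cV[R]_n) (m : 'X_{1..n}) : R :=
  \sum_j w j ord0 * (m j)%:R.

(* The sum of the terms of maximal w-weight. *)
Definition init_form (R : numDomainType) (K : comNzRingType) n
    (w : 'cV[R]_n) (f : {mpoly K[n]}) : {mpoly K[n]} :=
  \sum_(m <- msupp f | all (fun m' => wdeg w m' <= wdeg w m) (msupp f))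
    f@_m *: 'X_[m].

Definition init_ideal (R : numDomainType) (K : comNzRingType) n
    (w : 'cV[R]_n) (I : set {mpoly K[n]}) : set {mpoly K[n]} :=
  ideal_gen [set init_form w f | f in I]%classic.

Definition monomial_ideal (K : comNzRingType) n (I : set {mpoly K[n]}) : Prop :=
  exists S : set 'X_{1..n},
    I = ideal_gen [set ('X_[m] : {mpoly K[n]}) | m in S]%classic.

(* Meaningful when [init_ideal w I] is a monomial ideal; w need not come from
   a term order, so the ideal generated by G is required to be I. *)
Definition reduced_GB (R : numDomainType) (K : comNzRingType) n
    (w : 'cV[R]_n) (I G : set {mpoly K[n]}) : Prop :=
  [/\ ideal_gen G = I,
      ideal_gen [set init_form w f | f in G]%classic = init_ideal w I,
      forall f, G f -> exists m, init_form w f = 'X_[m] &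
      forall f m, G f -> m \in msupp f ->
        ~ ideal_gen [set init_form w f' | f' in (G `\ f)]%classic 'X_[m]].

Definition lattice_binomial (K : comNzRingType) n (u : 'cV[int]_n) :
    {mpoly K[n]} :=
  'X_[pos_part u] - 'X_[pos_part (- u)].

Definition falling (K : comNzRingType) n (v : 'cV[K]_n) (u : 'X_{1..n}) : K :=
  \prod_j \prod_(k < u j) (v j ord0 - k%:R).

Definition nsupp (K : nzRingType) n (v : 'cV[K]_n) : {set 'I_n} :=
  [set j | `[< exists k : nat, v j ord0 = - (k.+1)%:R >]].

Definition fake_exponent (R : numDomainType) (K : comNzRingType) d n
    (A : 'M[int]_(d, n)) (beta : 'cV[K]_d) (w : 'cV[R]_n) (v : 'cV[K]_n) :
    Prop :=
  map_mx intr A *m v = beta /\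
  forall u, lattice A u ->
    wdeg w (pos_part (- u)) < wdeg w (pos_part u) ->
    falling v (pos_part u) = 0.

(* I_u = nsupp (v + u) *)
Definition Isupp (K : nzRingType) n (v : 'cV[K]_n) (u : 'cV[int]_n) :
    {set 'I_n} :=
  nsupp (v + map_mx intr u).

Definition msuppB n h (B : 'M[int]_(n, h)) : {set 'I_n} :=
  [set j | row j B != 0].

Definition linform (K : comNzRingType) n h (B : 'M[int]_(n, h)) (j : 'I_n) :
    {mpoly K[h]} :=
  \sum_(k < h) (B j k)%:~R *: 'X_k.

Definition linprod (K : comNzRingType) n h (B : 'M[int]_(n, h))
    (J : {set 'I_n}) : {mpoly K[h]} :=
  \prod_(j in J) linform K B j.

Definition cone_w n M (g : 'I_M -> 'cV[int]_n) : set 'cV[int]_n :=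
  [set u | exists c : 'I_M -> nat, u = \sum_i g i *+ c i]%classic.

Definition NSw (K : nzRingType) d n M (A : 'M[int]_(d, n))
    (g : 'I_M -> 'cV[int]_n) (v : 'cV[K]_n) : {set {set 'I_n}} :=
  [set I | `[< exists u, [/\ lattice A u, I = Isupp v u &
     forall u', lattice A u' -> Isupp v u' = Isupp v u -> cone_w g u'] >]].

Definition calN (K : nzRingType) d n h M (A : 'M[int]_(d, n))
    (B : 'M[int]_(n, h)) (g : 'I_M -> 'cV[int]_n) (v : 'cV[K]_n) :
    {set {set 'I_n}} :=
  [set I in NSw A g v | msuppB B :|: I == msuppB B :|: Isupp v 0].

Definition calNc (K : nzRingType) d n h M (A : 'M[int]_(d, n))
    (B : 'M[int]_(n, h)) (g : 'I_M -> 'cV[int]_n) (v : 'cV[K]_n) :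
    {set {set 'I_n}} :=
  [set I | `[< exists u, [/\ lattice A u, I = Isupp v u &
     msuppB B :|: Isupp v u = msuppB B :|: Isupp v 0] >]] :\: calN A B g v.

Definition KN (K : nzRingType) d n h M (A : 'M[int]_(d, n))
    (B : 'M[int]_(n, h)) (g : 'I_M -> 'cV[int]_n) (v : 'cV[K]_n) :
    {set 'I_n} :=
  \bigcap_(I in calN A B g v) I.

Definition m_s (K : comNzRingType) d n h M (A : 'M[int]_(d, n))
    (B : 'M[int]_(n, h)) (g : 'I_M -> 'cV[int]_n) (v : 'cV[K]_n) :
    {mpoly K[h]} :=
  linprod K B (Isupp v 0 :\: KN A B g v).

Definition PN (K : comNzRingType) d n h M (A : 'M[int]_(d, n))
    (B : 'M[int]_(n, h)) (g : 'I_M -> 'cV[int]_n) (v : 'cV[K]_n) :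
    set {mpoly K[h]} :=
  ideal_gen [set p : {mpoly K[h]} | exists I J : {set 'I_n},
    [/\ I \in calN A B g v, J \in calNc A B g v &
        p = linprod K B ((I :|: J) :\: KN A B g v)]]%classic.

Definition Gset (K : nzRingType) n (v : 'cV[K]_n) (u : 'cV[int]_n) :
    {set 'I_n} :=
  Isupp v (- u) :\: Isupp v 0.

Definition PB (K : comNzRingType) n h M (B : 'M[int]_(n, h))
    (g : 'I_M -> 'cV[int]_n) (v : 'cV[K]_n) : set {mpoly K[h]} :=
  ideal_gen [set linprod K B (Gset v (g i)) | i in setT]%classic.

(* U(d_z) applied to q(z). Elements of K[d_s] are encoded as polynomials in
   {mpoly K[h]} through the substitution z = d_s, so [diffop U q] is both the
   action of U(d_s) on q(s) and U(d_z) * q(d_s). *)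
Definition diffop (K : comNzRingType) h (U q : {mpoly K[h]}) : {mpoly K[h]} :=
  \sum_(m <- msupp U) U@_m *: q^`M[m].

Definition orth (K : comNzRingType) h (P : set {mpoly K[h]}) :
    set {mpoly K[h]} :=
  [set q | forall p, P p -> (diffop q p).@[fun=> 0] = 0]%classic.

Definition star_img (K : comNzRingType) h (U : {mpoly K[h]})
    (Q : set {mpoly K[h]}) : set {mpoly K[h]} :=
  [set diffop U q | q in Q]%classic.

Definition mul_img (T : comNzRingType) (m : T) (P : set T) : set T :=
  [set m * p | p in P]%classic.

(* Main.v *)
(* Let <q, p> be the value at 0 of q(d) p.  It is symmetric and U(d) is adjoint
   to multiplication by U, so (i) amounts to m P_B being contained in P_N and
   P_N in P_B.  For the first, if u is in L and u_- is divisible by no leading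
   monomial g_+^(i), then reducing u_+ modulo the Groebner basis ends in the
   standard monomial u_-, whence u is in C(w).  So u outside C(w) gives some
   g_+^(i) <= u_-, and then G^(i) is contained in I_u \ I_0.  Since v is a fake
   exponent, G^(i) is nonempty, and therefore I_0 belongs to N; moreover
   I_{-g^(i)} does not, because g^(i) has positive weight.  Parts (ii) and (iii)
   follow by duality in each degree: a graded subspace is recovered from its
   orthogonal, and U(d) is surjective for homogeneous U <> 0. *)

Require Import Defs.
From HB Require Import structures.
From mathcomp Require Import all_boot all_order all_algebra.
From mathcomp Require Import boolp classical_sets reals complex mpoly.
From mathcomp Require Import ssrcomplements zify.

Set Implicit Arguments.
Unset Strict Implicit.
Unset Printing Implicit Defensive.

Import Order.TTheory GRing.Theory Num.Theory.

Local Open Scope ring_scope.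

(** * Sums over the support of a polynomial *)

Section SupportSums.
Variables (K : nzRingType) (V : lmodType K) (n : nat) (F : 'X_{1..n} -> V).
Implicit Types p q : {mpoly K[n]}.

Lemma msupp_sumwE k p : (msize p <= k)%N ->
  \sum_(m <- msupp p) p@_m *: F m = \sum_(m : 'X_{1..n < k}) p@_m *: F m.
Proof.
move=> lepk; rewrite (big_mksub 'X_{1..n < k}) ?msupp_uniq //=; last first.
  by move=> m /msize_mdeg_lt /leq_trans; apply.
by rewrite big_rmcond //= => m /memN_msupp_eq0 ->; rewrite scale0r.
Qed.

(** Over one bounded index set of monomials common to all three sums, linearity holds termwise. With
    [F] arbitrary, this serves both the left argument of [diffop] and the fiber functional on the
    toric ideal. *)
Lemma msupp_sumP c p q :
  \sum_(m <- msupp (c *: p + q)) (c *: p + q)@_m *: F m =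
  c *: (\sum_(m <- msupp p) p@_m *: F m) + \sum_(m <- msupp q) q@_m *: F m.
Proof.
pose k := maxn (msize (c *: p + q)) (maxn (msize p) (msize q)).
rewrite !(@msupp_sumwE k) ?leq_max ?leqnn ?orbT //.
rewrite scaler_sumr -big_split /=; apply: eq_bigr => m _.
by rewrite mcoeffD mcoeffZ scalerDl scalerA.
Qed.

End SupportSums.

(** * The differential pairing *)

Section DifferentialPairing.
Variables (K : comNzRingType) (h : nat).
Implicit Types (U V p q : {mpoly K[h]}) (m : 'X_{1..h}).

Fact diffop_is_linear U : linear (diffop U).
Proof.
move=> c p q; rewrite /diffop scaler_sumr -big_split /=.
apply: eq_bigr => m _.
by rewrite linearP scalerDr !scalerA mulrC.
Qed.

HB.instance Definition _ U :=
  GRing.isLinear.Build K {mpoly K[h]} {mpoly K[h]} _ (diffop U)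
    (diffop_is_linear U).

Lemma diffopPl c U V q : diffop (c *: U + V) q = c *: diffop U q + diffop V q.
Proof. exact: msupp_sumP (fun m => q^`M[m]) c U V. Qed.

Lemma diffop0l q : diffop 0 q = 0.
Proof. by rewrite /diffop msupp0 big_nil. Qed.

Lemma diffopX m q : diffop 'X_[m] q = q^`M[m].
Proof. by rewrite /diffop msuppX big_seq1 mcoeffX eqxx scale1r. Qed.

Lemma diffop1 q : diffop 1 q = q.
Proof. by rewrite -mpolyX0 diffopX mderivm0m. Qed.

(** Iterated derivatives add their exponents; this is the monomial case of [diffopM]. *)
Lemma diffop_mderivm U m q : diffop U q^`M[m] = diffop (U * 'X_[m]) q.
Proof.
elim/mpolyind: U => [|c m' p _ _ IHp]; first by rewrite mul0r !diffop0l.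
rewrite mulrDl -scalerAl -mpolyXD !diffopPl IHp !diffopX.
by rewrite addmC mderivmDm.
Qed.

Lemma diffopM U V q : diffop (U * V) q = diffop U (diffop V q).
Proof.
elim/mpolyind: V => [|c m p _ _ IHp].
  by rewrite mulr0 !diffop0l linear0.
rewrite mulrDr -scalerAr !diffopPl IHp -diffop_mderivm diffopX.
by rewrite linearP.
Qed.

Definition dpair q p := (diffop q p).@[fun=> 0].

Lemma meval_at0 p : p.@[fun=> 0] = p@_0%MM.
Proof.
elim/mpolyind: p => [|c m p _ _ IHp]; first by rewrite meval0 mcoeff0.
rewrite mevalD mevalZ mcoeffD mcoeffZ IHp mevalX mcoeffX; congr (_ * _ + _).
case: eqP => [->|/eqP nz_m]; first by rewrite big1 // => i _; rewrite mnm0E.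
have /existsP[i mi_neq0] : [exists i, m i != 0%N].
  rewrite -negb_forall; apply: contra nz_m => /forallP m0.
  by apply/eqP/mnmP => i; rewrite mnm0E; apply/eqP; rewrite m0.
by rewrite (bigD1 i) //= expr0n (negPf mi_neq0) mul0r.
Qed.

Definition mfact m : nat := (\prod_(i < h) (m i)`!)%N.

(** Distinct monomials are orthogonal and each pairs with itself to [mfact m], so the pairing
    becomes visibly symmetric. *)
Lemma dpairwE k p q : (msize q <= k)%N ->
  dpair q p = \sum_(m : 'X_{1..h < k}) q@_m * p@_m *+ mfact m.
Proof.
move=> leqk; rewrite /dpair meval_at0 /diffop (msupp_sumwE _ leqk) raddf_sum /=.
apply: eq_bigr => m _; rewrite mcoeffZ mcoeff_mderivm addm0 -mulrnAr.
by congr (_ * (_ *+ _)); apply: eq_bigr => i _; rewrite ffactnn.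
Qed.

Lemma dpairC p q : dpair p q = dpair q p.
Proof.
rewrite (dpairwE _ (leq_maxl (msize p) (msize q))).
rewrite (dpairwE _ (leq_maxr (msize p) (msize q))).
by apply: eq_bigr => m _; rewrite mulrC.
Qed.

Fact dpair_is_linear q : linear_for *%R (dpair q).
Proof. by move=> c p p'; rewrite /dpair linearP mevalD mevalZ. Qed.

HB.instance Definition _ q :=
  GRing.isLinear.Build K {mpoly K[h]} K _ (dpair q) (dpair_is_linear q).

(** Adjointness: by symmetry the factor [U] moves to the operator side, where products act by
    composition. *)
Lemma dpair_diffop U q p : dpair (diffop U q) p = dpair q (U * p).
Proof. by rewrite [LHS]dpairC [RHS]dpairC mulrC /dpair diffopM. Qed.

Lemma dpairX m p : dpair 'X_[m] p = p@_m *+ mfact m.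
Proof.
rewrite /dpair diffopX meval_at0 mcoeff_mderivm addm0; congr (_ *+ _).
by apply: eq_bigr => i _; rewrite ffactnn.
Qed.

Lemma orthE P q : orth P q <-> forall p, P p -> dpair q p = 0.
Proof. by []. Qed.

End DifferentialPairing.

(** * Homogeneous components and graded ideals *)

Section HomogeneousComponents.
Variables (K : comNzRingType) (h : nat).
Implicit Types (U p q f : {mpoly K[h]}) (m : 'X_{1..h}).

Lemma mcoeff_pihomog e p m :
  (pihomog mdeg e p)@_m = if mdeg m == e then p@_m else 0.
Proof.
elim/mpolyind: p => [|c m' p _ _ IHp].
  by rewrite linear0 mcoeff0; case: ifP.
rewrite linearP /= mcoeffD mcoeffZ IHp pihomogX mcoeffD mcoeffZ.
case: (eqVneq m' m) => [->|ne].
  by case: (mdeg m == e); rewrite ?mcoeff0 ?mulr0 ?addr0.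
have X0 : ('X_[m'] : {mpoly K[h]})@_m = 0 by rewrite mcoeffX (negPf ne).
rewrite X0 mulr0 add0r; case: (mdeg m' == e).
  by rewrite X0 mulr0 add0r.
by rewrite mcoeff0 mulr0 add0r.
Qed.

Lemma pihomog_mderivm k m q :
  pihomog mdeg k q^`M[m] = (pihomog mdeg (mdeg m + k) q)^`M[m].
Proof.
apply/mpolyP => m'; rewrite mcoeff_pihomog !mcoeff_mderivm mcoeff_pihomog.
by rewrite mdegD eqn_add2l; case: ifP; rewrite ?mul0rn.
Qed.

Lemma pihomog_diffop e k U q : U \is e.-homog ->
  pihomog mdeg k (diffop U q) = diffop U (pihomog mdeg (e + k) q).
Proof.
move=> /dhomogP homU; rewrite /diffop raddf_sum /=.
apply: eq_big_seq => m /homU /= <-.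
by rewrite linearZ /= pihomog_mderivm.
Qed.

(** The cofactor collects the terms of [p] of degree [k - e]. It stays unspecified, since only
    membership in an ideal matters later. *)
Lemma pihomogM e k f p : f \is e.-homog ->
  exists p', pihomog mdeg k (p * f) = p' * f.
Proof.
move=> homf; elim/mpolyind: p => [|c m p _ _ [p' IHp]].
  by exists 0; rewrite !mul0r linear0.
rewrite mulrDl -scalerAl linearP /= IHp.
have homXf : 'X_[m] * f \is (mdeg m + e).-homog.
  by apply: dhomogM; rewrite // dhomogX.
have [eq_k|ne_k] := eqVneq (mdeg m + e)%N k.
  exists (c *: 'X_[m] + p').
  by rewrite pihomog_dE -?eq_k // mulrDl -scalerAl.
by exists p'; rewrite (pihomog_ne0 ne_k homXf) scaler0 add0r.
Qed.

Lemma pihomog_ideal_gen (S : set {mpoly K[h]}) k p :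
    (forall f, S f -> exists e, f \is e.-homog) ->
  ideal_gen S p -> ideal_gen S (pihomog mdeg k p).
Proof.
move=> homS [r [c [f [Sf ->]]]].
have /choice[c' c'E] i : exists c', pihomog mdeg k (c i * f i) = c' * f i.
  by have [e homf] := homS _ (Sf i); apply: pihomogM homf.
exists r, c', f; split => //.
by rewrite raddf_sum /=; apply: eq_bigr => i _; rewrite c'E.
Qed.

End HomogeneousComponents.

(** * Duality for graded subspaces *)

Definition subspace (K : pzRingType) (V : lmodType K) (W : set V) : Prop :=
  W 0 /\ forall c x y, W x -> W y -> W (c *: x + y).

Section Separation.
Variable (K : fieldType).

(* A family of rows in W of maximal rank spans W, and its cokernel separates. *)
Lemma rowspace_separation N (W : set 'rV[K]_N) (x : 'rV[K]_N) :
    subspace W -> ~ W x ->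
  exists y : 'cV[K]_N, (forall z, W z -> z *m y = 0) /\ x *m y != 0.
Proof.
move=> [W0 Wlin] nWx.
pose P r := `[< exists X : 'M[K]_N, \rank X = r /\ forall i, W (row i X) >].
have P0 : exists r, P r.
  by exists 0%N; apply/asboolP; exists 0; split=> [|i]; rewrite ?mxrank0 ?row0.
have Pub r : P r -> (r <= N)%N.
  by move=> /asboolP[X [<- _]]; apply: rank_leq_col.
case: (ex_maxnP P0 Pub) => r /asboolP[X [rkX WX]] rmax.
have WsubX z : (z <= X)%MS -> W z.
  move=> /submxP[D ->]; rewrite mulmx_sum_row.
  elim/big_ind: _ => [//|a b Wa Wb|i _].
    by have := Wlin 1 a b Wa Wb; rewrite scale1r.
  by have := Wlin (D 0 i) (row i X) 0 (WX i) W0; rewrite addr0.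
have XW z : W z -> (z <= X)%MS.
  move=> Wz; apply: submx_trans (addsmxSr X z) _.
  rewrite -(geq_leqif (mxrank_leqif_sup (addsmxSl X z))) rkX.
  have lek : (\rank (X + z)%MS <= N)%N by apply: rank_leq_col.
  apply: rmax; apply/asboolP; exists (X + z)%MS; split=> // i.
  have /sub_addsmxP[[a b] /= ->] := row_sub i (X + z)%MS.
  rewrite addrC [b]mx11_scalar mul_scalar_mx; apply: Wlin => //.
  by apply: WsubX; apply: submxMl.
have : ~~ (x <= X)%MS by apply/negP => /WsubX.
rewrite submxE => /eqP/matrixP nz.
have [j nzj] : exists j, (x *m cokermx X) 0 j != 0.
  apply/existsP; apply: contraPT nz => /existsPn z nz.
  by apply: nz => a b; rewrite ord1 [RHS]mxE; apply/eqP; rewrite -[_ == _]negbK z.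
exists (col j (cokermx X)); split=> [z /XW|].
  by rewrite submxE colE mulmxA => /eqP ->; rewrite mul0mx.
rewrite colE mulmxA -colE; apply: contra nzj => /eqP/matrixP/(_ 0 0).
by rewrite [LHS]mxE [RHS]mxE => ->.
Qed.

Variable h : nat.
Hypothesis charK : [pchar K] =i pred0.
Implicit Types (W : set {mpoly K[h]}) (p q f r : {mpoly K[h]}).

End Separation.

Section GradedDuality.
Variables (K : fieldType) (h : nat).
Hypothesis charK : [pchar K] =i pred0.
Implicit Types (W : set {mpoly K[h]}) (U p q f r : {mpoly K[h]}).

Lemma mfact_neq0 (m : 'X_{1..h}) : (mfact m)%:R != 0 :> K.
Proof.
rewrite (proj1 (pcharf0P K) charK) -lt0n /mfact.
by apply: prodn_gt0 => i; apply: fact_gt0.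
Qed.

Lemma graded_separation W r : subspace W ->
    (forall e f, W f -> W (pihomog mdeg e f)) -> ~ W r ->
  exists p, (forall f, W f -> dpair p f = 0) /\ dpair p r != 0.
Proof.
move=> [W0 Wlin] Wgr nWr.
(* As [W] is closed under sums, some component of [r] escapes it; the problem moves to a single
   degree, hence to finite dimension. *)
have [e nWre] : exists e, ~ W (pihomog mdeg e r).
  apply: contra_notP nWr => /forallNP Wr.
  rewrite (pihomog_partitionE (leqnn (mmeasure mdeg r))).
  elim/big_ind: _ => [//|a b Wa Wb|i _]; last by apply: contrapT.
  by have := Wlin 1 a b Wa Wb; rewrite scale1r.
pose T : finType := 'X_{1..h < e.+1}.
pose coord f : 'rV[K]_#|T| := \row_i (pihomog mdeg e f)@_(val (enum_val i)).
have coordP c f f' : coord (c *: f + f') = c *: coord f + coord f'.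
  by apply/rowP => i; rewrite !mxE linearP /= mcoeffD mcoeffZ.
have coord_inj f f' : coord f = coord f' ->
    pihomog mdeg e f = pihomog mdeg e f'.
  move=> /rowP eqff'; apply/mpolyP => m; rewrite !mcoeff_pihomog.
  case: eqP => // mdm; have ltm : (mdeg m < e.+1)%N by rewrite mdm.
  have := eqff' (enum_rank (BMultinom ltm : T)).
  by rewrite !mxE enum_rankK /= !mcoeff_pihomog mdm eqxx.
have [y [Wy ry]] : exists y : 'cV[K]_#|T|,
    (forall z, [set coord f | f in W]%classic z -> z *m y = 0) /\
    coord r *m y != 0.
  apply: rowspace_separation.
    split; first exists 0 => //.
      by apply/rowP => i; rewrite !mxE linear0 mcoeff0.
    move=> c _ _ [f Wf <-] [f' Wf' <-]; exists (c *: f + f') => //.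
    exact: Wlin.
  by move=> [f Wf /coord_inj eqfr]; apply: nWre; rewrite -eqfr; apply: Wgr.
(* Dividing by [mfact] cancels the factor of the pairing, so pairing with [p] is the functional [y];
   this needs characteristic zero. The projection drops the monomials of [T] of degree below [e]. *)
pose p : {mpoly K[h]} :=
  \sum_(i < #|T|) (y i 0 / (mfact (val (enum_val i)))%:R)
    *: pihomog mdeg e 'X_[val (enum_val i)].
have pE f : dpair p f = (coord f *m y) 0 0.
  rewrite dpairC linear_sum mxE; apply: eq_bigr => i _.
  rewrite linearZ /= mxE mcoeff_pihomog pihomogX.
  case: eqP => _; last by rewrite linear0 mulr0 mul0r.
  rewrite dpairC dpairX -[f@__ *+ _]mulr_natr mulrC -mulrA.
  by rewrite [_%:R * _]mulrC divfK ?mfact_neq0.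
exists p; split=> [f Wf|]; first by rewrite pE Wy ?mxE //; exists f.
by rewrite pE; apply: contra ry => /eqP r0; apply/eqP/matrixP => i j;
  rewrite !ord1 r0 mxE.
Qed.

Lemma orth_orth P r : subspace P ->
    (forall e f, P f -> P (pihomog mdeg e f)) ->
  (forall q, orth P q -> dpair q r = 0) -> P r.
Proof.
move=> Psub Pgr Pr; apply: contrapT => /(graded_separation Psub Pgr)[p [pP]].
by rewrite Pr ?eqxx.
Qed.

Lemma dpair_nondegenerate f : (forall q, dpair q f = 0) -> f = 0.
Proof.
move=> f0; apply/mpolyP => m; have /eqP := f0 'X_[m].
by rewrite dpairX -mulr_natr mulf_eq0 (negPf (mfact_neq0 m)) orbF mcoeff0 => /eqP.
Qed.

(* The range of U(d) is graded, and its orthogonal is the annihilator of U. *)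
Lemma diffop_surj e U r : U \is e.-homog -> U != 0 -> exists q, diffop U q = r.
Proof.
move=> homU nzU; apply: contrapT => nr.
have [||//|p [pU]] := @graded_separation (range (diffop U)) r.
- split; first by exists 0; rewrite ?linear0.
  by move=> c _ _ [q _ <-] [q' _ <-]; exists (c *: q + q'); rewrite ?linearP.
- move=> k _ [q _ <-]; exists (pihomog mdeg (e + k) q) => //.
  by rewrite (pihomog_diffop _ _ homU).
- by move=> [q _ eqr]; apply: nr; exists q.
have /dpair_nondegenerate/eqP : forall q, dpair q (U * p) = 0.
  by move=> q; rewrite -dpair_diffop dpairC pU //; exists q.
by rewrite mulf_eq0 (negPf nzU) => /eqP ->; rewrite dpairC linear0 eqxx.
Qed.

End GradedDuality.

(** * Ideals generated by a set *)

Section IdealGen.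
Variables (T : comNzRingType) (S : set T).

Lemma ideal_gen0 : ideal_gen S 0.
Proof. by exists 0%N, (fun=> 0), (fun=> 0); split=> [[]|]; rewrite ?big_ord0. Qed.

Lemma ideal_gen_sub p : S p -> ideal_gen S p.
Proof.
by move=> Sp; exists 1%N, (fun=> 1), (fun=> p); split; rewrite // big_ord1 mul1r.
Qed.

Lemma ideal_genD p q : ideal_gen S p -> ideal_gen S q -> ideal_gen S (p + q).
Proof.
move=> [k [c [f [Sf ->]]]] [k' [c' [f' [Sf' ->]]]].
pose glue (a : 'I_k -> T) (a' : 'I_k' -> T) i :=
  match split i with inl j => a j | inr j => a' j end.
exists (k + k')%N, (glue c c'), (glue f f'); split.
  by move=> i; rewrite /glue; case: split.
rewrite big_split_ord /glue; congr (_ + _); apply: eq_bigr => i _.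
  by rewrite (unsplitK (inl i)).
by rewrite (unsplitK (inr i)).
Qed.

Lemma ideal_genM a p : ideal_gen S p -> ideal_gen S (a * p).
Proof.
move=> [k [c [f [Sf ->]]]]; exists k, (fun i => a * c i), f; split=> //.
by rewrite mulr_sumr; apply: eq_bigr => i _; rewrite mulrA.
Qed.

Lemma ideal_genP (P : set T) : P 0 ->
    (forall a p, P p -> P (a * p)) -> (forall p q, P p -> P q -> P (p + q)) ->
  (S `<=` P)%classic -> (ideal_gen S `<=` P)%classic.
Proof.
move=> P0 PM PD SP p [k [c [f [Sf ->]]]].
by elim/big_ind: _ => [//|a b|i _]; [apply: PD | apply/PM/SP].
Qed.

End IdealGen.

Lemma ideal_gen_subspace (K : comNzRingType) h (S : set {mpoly K[h]}) :
  subspace (ideal_gen S).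
Proof.
split=> [|c x y Sx Sy]; first exact: ideal_gen0.
by rewrite -mul_mpolyC; apply: ideal_genD => //; apply: ideal_genM.
Qed.

(** * Reduction modulo the Groebner basis *)

Section PosPart.
Variable n : nat.
Implicit Types (u : 'cV[int]_n) (m : 'X_{1..n}).

Lemma pos_partE u j : (pos_part u j)%:Z = Num.max (u j 0) 0.
Proof. by rewrite mnmE gez0_abs // le_max lexx orbT. Qed.

Lemma mnm_colD m m' : mnm_col (m + m')%MM = mnm_col m + mnm_col m'.
Proof. by apply/colP => j; rewrite !mxE mnmDE PoszD. Qed.

Lemma mnm_col_pos_part u :
  mnm_col (pos_part u) - mnm_col (pos_part (- u)) = u.
Proof.
apply/colP => j; rewrite !mxE !pos_partE mxE.
by move: (u j 0) => x; lia.
Qed.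

Variables (R : numDomainType) (w : 'cV[R]_n).

(** On integer vectors the weight is additive, and comparing u_+ with u_- becomes a sign condition
    on u. *)
Definition wdegz u : R := \sum_j w j ord0 * (u j ord0)%:~R.

Fact wdegz_is_additive : zmod_morphism wdegz.
Proof.
move=> u u'; rewrite /wdegz -sumrB; apply: eq_bigr => j _.
by rewrite !mxE intrB mulrBr.
Qed.

HB.instance Definition _ :=
  GRing.isZmodMorphism.Build 'cV[int]_n R wdegz wdegz_is_additive.

Lemma wdegE m : wdeg w m = wdegz (mnm_col m).
Proof. by apply: eq_bigr => j _; rewrite mxE. Qed.

Lemma wdegz_pos_part u :
  (wdeg w (pos_part (- u)) < wdeg w (pos_part u)) = (0 < wdegz u).
Proof. by rewrite !wdegE -subr_gt0 -raddfB mnm_col_pos_part. Qed.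

End PosPart.

Section ConeOfVectors.
Variables (n M : nat) (g : 'I_M -> 'cV[int]_n).

Lemma cone_w0 : cone_w g 0.
Proof. by exists (fun=> 0%N); rewrite big1. Qed.

Lemma cone_wD u u' : cone_w g u -> cone_w g u' -> cone_w g (u + u').
Proof.
move=> [c ->] [c' ->]; exists (fun i => c i + c' i)%N.
by rewrite -big_split /=; apply: eq_bigr => i _; rewrite mulrnDr.
Qed.

Lemma cone_w_gen i : cone_w g (g i).
Proof.
exists (fun j => (j == i) : nat); rewrite (bigD1 i) //= eqxx mulr1n.
by rewrite big1 ?addr0 // => j /negPf ->; rewrite mulr0n.
Qed.

Lemma wdegz_cone_ge0 (R : numDomainType) (w : 'cV[R]_n) u :
  (forall i, 0 < wdegz w (g i)) -> cone_w g u -> 0 <= wdegz w u.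
Proof.
move=> gpos [c ->]; rewrite raddf_sum /=; apply: sumr_ge0 => i _.
by rewrite raddfMn; apply: mulrn_wge0; exact: ltW (gpos i).
Qed.

End ConeOfVectors.

(** * Initial forms of binomials *)

Section InitialForms.
Variables (R : realDomainType) (K : numDomainType) (n : nat) (w : 'cV[R]_n).
Implicit Types (f : {mpoly K[n]}) (a b m : 'X_{1..n}).

Lemma mcoeff_init_form f m : (init_form w f)@_m =
  if all (fun m' => wdeg w m' <= wdeg w m) (msupp f) then f@_m else 0.
Proof.
rewrite /init_form big_mkcond raddf_sum /=.
have [mf|nmf] := boolP (m \in msupp f).
  rewrite (bigD1_seq m) ?msupp_uniq //= big1 ?addr0 => [|m' ne].
    by case: ifP => _; rewrite ?mcoeff0 // mcoeffZ mcoeffX eqxx mulr1.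
  by case: ifP => _; rewrite ?mcoeff0 // mcoeffZ mcoeffX (negPf ne) mulr0.
rewrite memN_msupp_eq0 // if_same big1_seq // => m' /= m'f.
case: ifP => _; rewrite ?mcoeff0 // mcoeffZ mcoeffX.
have [eqm|_] := eqVneq m' m; last by rewrite mulr0.
by rewrite eqm (negPf nmf) in m'f.
Qed.

Lemma msupp_binomial a b m : a != b ->
  (m \in msupp ('X_[a] - 'X_[b] : {mpoly K[n]})) = (m == a) || (m == b).
Proof.
move=> neab; rewrite mcoeff_msupp mcoeffB !mcoeffX.
case: (eqVneq a m) => [<-|ne_am].
  by rewrite [b == a]eq_sym (negPf neab) subr0 oner_eq0.
rewrite (eq_sym m b) sub0r oppr_eq0 /=.
by case: (b == m); rewrite /= ?oner_eq0 ?eqxx.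
Qed.

Lemma mcoeff_init_binomial a b m : a != b ->
  (init_form w ('X_[a] - 'X_[b] : {mpoly K[n]}))@_m =
  if (wdeg w a <= wdeg w m) && (wdeg w b <= wdeg w m)
  then (a == m)%:R - (b == m)%:R else 0.
Proof.
move=> neab; rewrite mcoeff_init_form mcoeffB !mcoeffX; congr (if _ then _ else _).
apply/allP/andP => [le|[lea leb] m'].
  by split; apply: le; rewrite msupp_binomial // eqxx ?orbT.
by rewrite msupp_binomial // => /orP[] /eqP ->.
Qed.

Lemma init_binomial_monomial a b m :
    init_form w ('X_[a] - 'X_[b]) = 'X_[m] :> {mpoly K[n]} ->
  wdeg w b < wdeg w a /\ m = a.
Proof.
move=> initE; have neab : a != b.
  apply/eqP => eqab; move/(congr1 (mcoeff m)): initE.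
  rewrite eqab subrr mcoeff_init_form mcoeff0 if_same mcoeffX eqxx => /eqP.
  by rewrite eq_sym oner_eq0.
have coefE k := mcoeff_init_binomial k neab.
have ltba : wdeg w b < wdeg w a.
  (* Otherwise ['X_[b]] would occur in the initial form with coefficient -1, while a monomial has
     coefficients 0 and 1 only. *)
  rewrite ltNge; apply/negP => leab.
  have := coefE b; rewrite initE leab lexx eqxx (negPf neab) mcoeffX sub0r.
  case: (m == b) => /= /eqP; rewrite -subr_eq0 opprK.
    by rewrite gt_eqF // addr_gt0.
  by rewrite add0r oner_eq0.
split=> //; have := coefE a; rewrite initE lexx ltW //= eqxx [b == a]eq_sym (negPf neab).
rewrite subr0 mcoeffX; case: eqP => // _ /eqP.
by rewrite eq_sym oner_eq0.
Qed.

(** The heavier of the two terms survives; in case of a tie [b] is chosen. *)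
Lemma msupp_init_binomial a b : a != b ->
  exists2 m, m \in msupp (init_form w ('X_[a] - 'X_[b] : {mpoly K[n]})) &
    m = a \/ m = b.
Proof.
move=> neab; case: (leP (wdeg w a) (wdeg w b)) => [leab|/ltW leba].
  exists b; last by right.
  rewrite mcoeff_msupp mcoeff_init_binomial // leab lexx eqxx (negPf neab).
  by rewrite sub0r oppr_eq0 oner_eq0.
exists a; last by left.
rewrite mcoeff_msupp mcoeff_init_binomial // leba lexx eqxx [b == a]eq_sym (negPf neab).
by rewrite subr0 oner_eq0.
Qed.

End InitialForms.

(** * Toric ideals and standard monomials *)

Section ToricIdeal.
Variables (K : numDomainType) (d n : nat) (A : 'M[int]_(d, n)).
Implicit Types (u : 'cV[int]_n) (a b m : 'X_{1..n}).

Lemma latticeP u : lattice A u <-> A *m u = 0.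
Proof. by []. Qed.

Lemma lattice0 : lattice A 0.
Proof. by rewrite latticeP mulmx0. Qed.

Lemma latticeN u : lattice A u -> lattice A (- u).
Proof. by rewrite !latticeP mulmxN => ->; rewrite oppr0. Qed.

Lemma lattice_pos_part u : lattice A u <->
  A *m mnm_col (pos_part u) = A *m mnm_col (pos_part (- u)).
Proof.
rewrite latticeP -[in X in X <-> _](mnm_col_pos_part u) mulmxBr.
by split=> [/eqP|->]; rewrite ?subrr // subr_eq0 => /eqP.
Qed.

Lemma toric_ideal_binomial a b : A *m mnm_col a = A *m mnm_col b ->
  toric_ideal K A ('X_[a] - 'X_[b]).
Proof. by move=> eqA; apply: ideal_gen_sub; exists a, b. Qed.

(* The coefficients of an element of I_A sum to zero over each fiber of A. *)
Lemma toric_binomial_fiber a b : toric_ideal K A ('X_[a] - 'X_[b]) ->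
  A *m mnm_col a = A *m mnm_col b.
Proof.
(* The indicator of the fiber of [a]; [K^o] makes the scalars a module, as [msupp_sumP] requires. *)
pose F m : K^o := (A *m mnm_col m == A *m mnm_col a)%:R.
pose phi (p : {mpoly K[n]}) : K^o := \sum_(m <- msupp p) p@_m *: F m.
have phiP c p q : phi (c *: p + q) = c *: phi p + phi q by apply: msupp_sumP.
have phi0 : phi 0 = 0 by rewrite /phi msupp0 big_nil.
have phiD p q : phi (p + q) = phi p + phi q.
  by have := phiP 1 p q; rewrite !scale1r.
have phiX m : phi 'X_[m] = F m.
  by rewrite /phi msuppX big_seq1 mcoeffX eqxx scale1r.
have phiB p q : phi (p - q) = phi p - phi q.
  by have := phiP (-1) q p; rewrite !scaleN1r addrC [RHS]addrC.
move=> [k [c [f [genf]]]] eq_ab.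
have : phi ('X_[a] - 'X_[b]) = 0.
  rewrite eq_ab; elim/big_ind: _ => [//|p q p0 q0|i _].
    by rewrite phiD p0 q0 addr0.
  have [m [m' [eqA ->]]] := genf i.
  (* Multiplying a generator by a monomial translates both exponents, which still share a fiber. *)
  elim/mpolyind: (c i) => [|z m0 p _ _ IHp]; first by rewrite mul0r.
  rewrite mulrDl -scalerAl phiP IHp addr0 mulrBr -!mpolyXD phiB !phiX /F.
  by rewrite !mnm_colD !mulmxDr eqA subrr scaler0.
rewrite phiB !phiX /F eqxx; case: eqP => [->//|_] /eqP.
by rewrite subr0 oner_eq0.
Qed.

(** The functional [c] takes the same nonzero value [z] on all columns, so it sends [A m] to [z]
    times the degree of [m]. *)
Lemma homogeneous_mdeg a b : homogeneous_mx A ->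
  A *m mnm_col a = A *m mnm_col b -> mdeg a = mdeg b.
Proof.
move=> [c [z [_ z0 cA]]] eqA.
have degE m : c *m map_mx intr (A *m mnm_col m) = (z * (mdeg m)%:R)%:M.
  rewrite map_mxM mulmxA; apply/matrixP => i j; rewrite !ord1 mxE mxE eqxx mulr1n.
  rewrite mdegE natr_sum mulr_sumr; apply: eq_bigr => k _.
  by rewrite cA !mxE.
have : z * (mdeg a)%:R = z * (mdeg b)%:R.
  by have /matrixP/(_ 0 0) := degE a; rewrite eqA degE !mxE eqxx !mulr1n.
by move/(mulfI z0)/eqP; rewrite eqr_nat => /eqP.
Qed.

Variables (R : realDomainType) (w : 'cV[R]_n) (M : nat).
Variable g : 'I_M -> 'cV[int]_n.
Hypothesis homA : homogeneous_mx A.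
Hypothesis gGB : reduced_GB w (toric_ideal K A)
  (range (fun i => lattice_binomial K (g i))).

Lemma GB_lattice i : lattice A (g i).
Proof.
have [GI _ _ _] := gGB.
apply/lattice_pos_part/toric_binomial_fiber; rewrite -GI.
by apply: ideal_gen_sub; exists i.
Qed.

(** A binomial whose initial form is a monomial with coefficient 1 must have its first term leading,
    which fixes the orientation of [g i]. *)
Lemma GB_init i :
  wdeg w (pos_part (- g i)) < wdeg w (pos_part (g i)) /\
  init_form w (lattice_binomial K (g i)) = 'X_[pos_part (g i)].
Proof.
have [_ _ Gmon _] := gGB.
have [|m initE] := Gmon (lattice_binomial K (g i)); first by exists i.
by have [lt mE] := init_binomial_monomial initE; rewrite initE mE.
Qed.

Lemma GB_wdegz i : 0 < wdegz w (g i).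
Proof. by rewrite -wdegz_pos_part; case: (GB_init i). Qed.

(** Polynomials all of whose monomials are divisible by some leading monomial form an ideal, and it
    contains the generators of the initial ideal. *)
Lemma init_ideal_divisible (f : {mpoly K[n]}) m :
    init_ideal w (toric_ideal K A) f -> m \in msupp f ->
  exists i, (pos_part (g i) <= m)%MM.
Proof.
have [_ <- _ _] := gGB => If; move: m.
pose P := [set p : {mpoly K[n]} | forall m, m \in msupp p ->
  exists i, (pos_part (g i) <= m)%MM]%classic.
suff /(_ f If) : (ideal_gen [set init_form w p |
  p in range (fun i => lattice_binomial K (g i))] `<=` P)%classic by [].
apply: ideal_genP => [m|q p IHp m|p q IHp IHq m|].
- by rewrite msupp0 in_nil.
- move=> /msuppM_le/allpairsP[[m1 m2] /= [_ /IHp[i le] ->]].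
  by exists i; rewrite (lepm_trans le) ?lem_addl.
- by move/msuppD_le; rewrite mem_cat => /orP[/IHp|/IHq].
- move=> _ [_ [i _ <-] <-] m; rewrite (GB_init i).2 msuppX inE => /eqP ->.
  by exists i; apply: lepm_refl.
Qed.

Definition standard m := forall i, ~~ (pos_part (g i) <= m)%MM.

(** If [a] and [b] differed, their binomial would lie in the toric ideal and its initial form would
    contain one of them, making that one divisible by a leading monomial. *)
Lemma standard_inj a b : A *m mnm_col a = A *m mnm_col b ->
  standard a -> standard b -> a = b.
Proof.
move=> eqA sa sb; apply/eqP; apply: contraT => neab.
have [m mi mab] := msupp_init_binomial K w neab.
have [|i] := init_ideal_divisible (f := init_form w ('X_[a] - 'X_[b])) _ mi.
  by apply: ideal_gen_sub; exists ('X_[a] - 'X_[b]) => //;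
    apply: toric_ideal_binomial.
by case: mab => ->; [rewrite (negPf (sa i)) | rewrite (negPf (sb i))].
Qed.

(* The weight need not be a term order; the division terminates because the
   fibers of A are finite by homogeneity. *)
Lemma normal_form a : exists b,
  [/\ A *m mnm_col a = A *m mnm_col b, cone_w g (mnm_col a - mnm_col b) &
      standard b].
Proof.
(* Induction on the number of lighter monomials of degree below a fixed [D]. *)
suff reduce D N : forall a', (mdeg a' < D)%N ->
    (#|[set x : 'X_{1..n < D} | (wdeg w x < wdeg w a')%R]| < N)%N ->
    exists b, [/\ A *m mnm_col a' = A *m mnm_col b,
      cone_w g (mnm_col a' - mnm_col b) & standard b].
  exact: (reduce _ _ a (ltnSn _) (ltnSn _)).
elim: N => // N IHN {}a ltaD ltaN.
have [/existsP[i le_ga]|] := boolP [exists i, (pos_part (g i) <= a)%MM]; last first.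
  rewrite negb_exists => /forallP sa; exists a; split => //.
  by rewrite subrr; apply: cone_w0.
(* One division step; it subtracts [g i] from the exponent, lowers the weight and keeps the
   degree. *)
pose a1 := (a - pos_part (g i) + pos_part (- g i))%MM.
have aE : mnm_col a = mnm_col a1 + g i.
  rewrite -[in LHS](submK le_ga) /a1 !mnm_colD -addrA; congr (_ + _).
  by rewrite -[X in _ + X]mnm_col_pos_part [RHS]addrC subrK.
have eqA : A *m mnm_col a = A *m mnm_col a1.
  by rewrite aE mulmxDr (GB_lattice i) addr0.
have lta1a : wdeg w a1 < wdeg w a.
  by rewrite !wdegE aE raddfD ltrDl GB_wdegz.
have lta1D : (mdeg a1 < D)%N by rewrite -(homogeneous_mdeg homA eqA).
have [|b [eqA1 a1b sb]] := IHN a1 lta1D.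
  rewrite -ltnS; apply: leq_trans ltaN; rewrite ltnS; apply: proper_card.
  apply/properP; split; first by
    apply/fintype.subsetP => x; rewrite !inE => /lt_trans; apply.
  (* The exponent [a1] itself leaves the set of lighter monomials. *)
  by exists (BMultinom lta1D); rewrite !inE ?ltxx.
exists b; split=> //; first by rewrite eqA.
by rewrite aE addrAC; apply: cone_wD => //; apply: cone_w_gen.
Qed.

(** By uniqueness the normal form of u_+ is u_-, and the division steps sum up to u. *)
Lemma cone_w_of_standard u :
  lattice A u -> standard (pos_part (- u)) -> cone_w g u.
Proof.
move=> /lattice_pos_part eqA su.
have [b [eqAb ub sb]] := normal_form (pos_part u).
rewrite -[u]mnm_col_pos_part (@standard_inj (pos_part (- u)) b) //.
by rewrite -eqA.
Qed.

End ToricIdeal.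

(** * Negative supports and the ideals P_N, P_B *)

Section NegativeSupport.
Variables (K : numDomainType) (n : nat) (v : 'cV[K]_n).
Implicit Types (u : 'cV[int]_n) (j : 'I_n).

(** Naming the integer value of [v j] turns support questions into integer inequalities. *)
Lemma in_Isupp u j : j \in Isupp v u <->
  exists2 z : int, v j 0 = z%:~R & z + u j 0 < 0.
Proof.
rewrite inE !mxE; split=> [/asboolP[k vk]|[z -> z_lt0]].
  exists (- (k.+1)%:Z - u j 0); last by rewrite subrK.
  by rewrite intrB mulrNz -vk addrK.
apply/asboolP; exists (absz (z + u j 0)).-1.
have zE : z + u j 0 = - ((absz (z + u j 0)).-1.+1)%:Z by lia.
by rewrite -intrD [in LHS]zE mulrNz.
Qed.

Lemma falling_eq0 (m : 'X_{1..n}) : falling v m = 0 ->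
  exists j, exists2 k : nat, v j 0 = k%:R & (k < m j)%N.
Proof.
move=> /eqP/prodf_eq0[j _ /prodf_eq0[k _]].
by rewrite subr_eq0 => /eqP vk; exists j, k.
Qed.

(** For j in the left side, [v j] is an integer z with 0 <= z < u_j; the hypothesis then gives -u'_j
    >= u_j > z. *)
Lemma Gset_sub u u' : (pos_part u <= pos_part (- u'))%MM ->
  Gset v u \subset Isupp v u' :\: Isupp v 0.
Proof.
move=> /mnm_lepP le; apply/fintype.subsetP => j; rewrite !finset.in_setD.
case/andP=> nj0 /in_Isupp[z vz]; rewrite nj0 mxE /= => ltz.
apply/in_Isupp; exists z => //.
have z_ge0 : 0 <= z.
  rewrite leNgt; apply: contra nj0 => z_lt0.
  by apply/in_Isupp; exists z; rewrite // mxE addr0.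
have := le j; rewrite -lez_nat !pos_partE !mxE.
by move: (u j 0) (u' j 0) ltz => x y; lia.
Qed.

(** A vanishing factor yields j with [v j] a natural number smaller than u_j, so subtracting u makes
    this entry negative. *)
Lemma Gset_falling u :
  falling v (pos_part u) = 0 -> exists j, j \in Gset v u.
Proof.
move=> /falling_eq0[j [k vk]]; rewrite -ltz_nat pos_partE => ltk; exists j.
rewrite finset.in_setD; apply/andP; split.
  apply/negP => /in_Isupp[z vz]; rewrite mxE addr0.
  have -> : z = k%:Z by apply: (@intr_inj K); rewrite -vz vk.
  by rewrite ltNge.
apply/in_Isupp; exists k%:Z; rewrite // mxE.
by move: (u j 0) ltk => x; lia.
Qed.

End NegativeSupport.

(** * Products of the linear forms of B *)

Section LinearForms.
Variables (K : numFieldType) (n h : nat) (B : 'M[int]_(n, h)).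
Implicit Types (j : 'I_n) (I J : {set 'I_n}).

Lemma linform_homog j : linform K B j \is 1.-homog.
Proof. by apply: rpred_sum => k _; apply: rpredZ; rewrite dhomogX /= mdeg1. Qed.

Lemma linprod_homog J : linprod K B J \is #|J|.-homog.
Proof.
rewrite /linprod -sum1_card.
elim/big_rec2: _ => [|j e p _ homp]; first exact: dhomog1.
exact: dhomogM (linform_homog j) homp.
Qed.

Lemma linform_eq0 j : (linform K B j == 0) = (j \notin msuppB B).
Proof.
rewrite inE negbK; apply/eqP/eqP => [lin0|row0].
  apply/rowP => k; have := congr1 (mcoeff U_(k)%MM) lin0.
  rewrite mcoeff0 /linform raddf_sum (bigD1 k) //= big1 => [|k' ne].
    rewrite addr0 mcoeffZ mcoeffX eqxx mulr1 !mxE => /eqP.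
    by rewrite intr_eq0 => /eqP.
  by rewrite mcoeffZ mcoeffX eq_mnm1 (negPf ne) mulr0.
rewrite /linform big1 // => k _.
by have /rowP/(_ k) := row0; rewrite !mxE => ->; rewrite scale0r.
Qed.

Lemma linprod_neq0 J : J \subset msuppB B -> linprod K B J != 0.
Proof.
move=> /fintype.subsetP sJ; apply/prodf_neq0 => j /sJ Bj.
by rewrite linform_eq0 negbK.
Qed.

Lemma linprod_eq0 J j : j \in J -> j \notin msuppB B -> linprod K B J = 0.
Proof.
by rewrite -linform_eq0 => Jj /eqP lin0; rewrite /linprod (bigD1 j) //= lin0
  mul0r.
Qed.

Lemma linprodU I J : [disjoint I & J] ->
  linprod K B (I :|: J) = linprod K B I * linprod K B J.
Proof.
move=> dIJ; rewrite /linprod -bigU //.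
by apply: eq_bigl => j; rewrite !inE.
Qed.

Lemma linprod_sub I J : I \subset J ->
  linprod K B J = linprod K B (J :\: I) * linprod K B I.
Proof.
move=> sIJ; rewrite -linprodU; last first.
  rewrite -finset.setI_eq0; apply/eqP/setP => j.
  by rewrite !inE; case: (j \in I); rewrite ?andbF.
by congr linprod; rewrite finset.setUC; apply/setP => j; rewrite !inE;
  case: (boolP (j \in I)) => // /(fintype.subsetP sIJ) ->.
Qed.

End LinearForms.

(** * The inclusions between the two ideals and their dual statements *)

Section FakeExponent.
Variables (R : realDomainType) (K : numFieldType) (d n h M : nat).
Variables (A : 'M[int]_(d, n)) (w : 'cV[R]_n) (v : 'cV[K]_n).
Variables (B : 'M[int]_(n, h)) (g : 'I_M -> 'cV[int]_n).
Hypothesis homA : homogeneous_mx A.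
Hypothesis v_fake : forall u, lattice A u ->
  wdeg w (pos_part (- u)) < wdeg w (pos_part u) -> falling v (pos_part u) = 0.
Hypothesis B_supp : forall u, lattice A u ->
  Isupp v 0 \subset msuppB B :|: Isupp v u.
Hypothesis gGB : reduced_GB w (toric_ideal K A)
  (range (fun i => lattice_binomial K (g i))).

Local Notation I0 := (Isupp v 0).
Local Notation N := (calN A B g v).
Local Notation KcalN := (KN A B g v).
Local Notation ms := (m_s A B g v).

Lemma Gset_neq0 i : exists j, j \in Gset v (g i).
Proof.
apply/Gset_falling/v_fake; first exact: GB_lattice gGB _.
by case: (GB_init gGB i).
Qed.

Lemma Gset_sub_notin_cone u : lattice A u -> ~ cone_w g u ->
  exists i, Gset v (g i) \subset Isupp v u :\: I0.
Proof.
move=> Lu nCu; have [i le] : exists i, (pos_part (g i) <= pos_part (- u))%MM.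
  apply: contra_notP nCu => nle; apply: (cone_w_of_standard homA gGB Lu) => i.
  by apply/negP => le; apply: nle; exists i.
by exists i; apply: Gset_sub.
Qed.

(** If I_u = I_0 with u outside the cone, a nonempty [Gset] would be contained in the empty set I_0
    minus I_0. *)
Lemma I0_in_N : I0 \in N.
Proof.
rewrite !inE eqxx andbT; apply/asboolP; exists 0; split=> // [|u Lu Iu].
  exact: lattice0.
apply: contrapT => nCu; have [k] := Gset_sub_notin_cone Lu nCu.
rewrite Iu; have [j Gj] := Gset_neq0 k => /fintype.subsetP/(_ j Gj).
by rewrite finset.in_setD andNb.
Qed.

Lemma KN_sub_I0 : KcalN \subset I0.
Proof. exact: finset.bigcap_inf I0_in_N. Qed.

(** Outside the support of B, every member of [N] agrees with I_0. Hence no factor of [ms] is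
    zero. *)
Lemma I0_diff_KN_sub_suppB : I0 :\: KcalN \subset msuppB B.
Proof.
apply/fintype.subsetP => j; rewrite finset.in_setD => /andP[nKj I0j].
apply: contraR nKj => nBj; apply/finset.bigcapP => I.
rewrite finset.inE => /andP[_ /eqP/setP/(_ j)].
by rewrite !finset.in_setU I0j (negPf nBj).
Qed.

Lemma m_s_neq0 : ms != 0.
Proof. exact: linprod_neq0 I0_diff_KN_sub_suppB. Qed.

Lemma m_s_homog : ms \is #|I0 :\: KcalN|.-homog.
Proof. exact: linprod_homog. Qed.

Lemma PN_sub_PB : (PN A B g v `<=` PB B g v)%classic.
Proof.
apply: ideal_genP => [||p q|]; first exact: ideal_gen0.
- by move=> *; apply: ideal_genM.
- exact: ideal_genD.
move=> _ [I [J [_ JNc ->]]].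
move: JNc; rewrite finset.in_setD !finset.inE.
move=> /andP[nJN /asboolP[u [Lu JE suppJ]]].
(* J meets the support condition but is not in [N], so one of its representatives lies outside the
   cone. *)
have [u' [Lu' IuE nCu']] :
    exists u', [/\ lattice A u', Isupp v u' = J & ~ cone_w g u'].
  apply: contrapT => nex; move: nJN; rewrite JE suppJ eqxx andbT => /negP; apply.
  apply/asboolP; exists u; split=> // u' Lu' Iu'.
  by apply: contrapT => nC; apply: nex; exists u'; rewrite JE.
have [k sG] := Gset_sub_notin_cone Lu' nCu'.
rewrite (@linprod_sub _ _ _ _ (Gset v (g k))).
  by apply: ideal_genM; apply: ideal_gen_sub; exists k.
apply/fintype.subsetP => j /(fintype.subsetP sG).
rewrite IuE !finset.in_setD finset.in_setU => /andP[nI0j ->]; rewrite orbT andbT.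
by apply: contra nI0j; apply: (fintype.subsetP KN_sub_I0).
Qed.

(** The vector [- g i] represents this set itself, and its negative weight keeps it out of the
    cone. *)
Lemma I_opp_g_notin_N i : Isupp v (- g i) \notin N.
Proof.
apply/negP; rewrite finset.inE => /andP[+ _].
rewrite finset.inE => /asboolP[u [Lu eqI CN]].
have Lg : lattice A (- g i) by apply/latticeN/(GB_lattice gGB).
have /(wdegz_cone_ge0 (GB_wdegz gGB)) := CN _ Lg eqI.
by rewrite raddfN oppr_ge0 leNgt (GB_wdegz gGB).
Qed.

Lemma m_s_mul_PB p : PB B g v p -> PN A B g v (ms * p).
Proof.
move=> [r [c [f [Gf ->]]]]; rewrite mulr_sumr.
elim/big_ind: _ => [|p1 p2|k _]; [exact: ideal_gen0 | exact: ideal_genD |].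
rewrite mulrCA; apply: ideal_genM.
have [i _ <-] := Gf k.
have Lg : lattice A (- g i) by apply/latticeN/(GB_lattice gGB).
(* In the equality case the product is the generator of P_N for I = I_0 and J = I_{-g}: its index
   set is the disjoint union of those of [ms] and of the generator of P_B. *)
have [eqS|neS] := eqVneq (msuppB B :|: Isupp v (- g i)) (msuppB B :|: I0).
  apply: ideal_gen_sub; exists I0, (Isupp v (- g i)); split.
  - exact: I0_in_N.
  - rewrite finset.in_setD I_opp_g_notin_N finset.inE; apply/asboolP.
    by exists (- g i).
  rewrite -linprodU /Gset.
    congr linprod; apply/setP => j.
    rewrite !(finset.in_setD, finset.in_setU).
    have := fintype.subsetP KN_sub_I0 j.
    by case: (j \in KcalN); case: (j \in I0) => //= /(_ isT).
  rewrite -finset.setI_eq0; apply/eqP/setP => j.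
  rewrite !(finset.in_setI, finset.in_setD, finset.in_set0).
  by case: (j \in I0); rewrite ?andbF.
(* By [B_supp] one inclusion always holds, so the other fails; the resulting index carries a zero
   linear form, which kills the generator of P_B. *)
have [j Ij nBI0] : exists2 j, j \in Isupp v (- g i) & j \notin msuppB B :|: I0.
  apply/fintype.subsetPn; apply: contra neS => sI.
  rewrite finset.eqEsubset !finset.subUset !finset.subsetUl sI /=.
  exact: B_supp.
move: nBI0; rewrite finset.in_setU negb_or => /andP[nBj nI0j].
rewrite (@linprod_eq0 _ _ _ _ (Gset v (g i)) j) ?mulr0 //; first exact: ideal_gen0.
by rewrite finset.in_setD nI0j.
Qed.

Lemma orth_PB_sub_orth_PN : (orth (PB B g v) `<=` orth (PN A B g v))%classic.
Proof. by move=> q qPB p /PN_sub_PB; apply: qPB. Qed.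

Lemma star_orth_PN : (star_img ms (orth (PN A B g v)) `<=` orth (PB B g v))%classic.
Proof.
move=> _ [q qPN <-]; apply/orthE => p PBp.
by rewrite dpair_diffop; apply: qPN; apply: m_s_mul_PB.
Qed.

Lemma orth_PN_eq_orth_PB : KcalN = I0 -> orth (PN A B g v) = orth (PB B g v).
Proof.
move=> eqK; apply/seteqP; split=> [q qPN|]; last exact: orth_PB_sub_orth_PN.
apply: star_orth_PN; exists q => //.
by rewrite /m_s eqK finset.setDv /linprod big_set0 diffop1.
Qed.

Lemma PN_homog k p : PN A B g v p -> PN A B g v (pihomog mdeg k p).
Proof.
apply: pihomog_ideal_gen => _ [I [J [_ _ ->]]].
by exists #|(I :|: J) :\: KcalN|; apply: linprod_homog.
Qed.

(** Forward: m(d)q pairs with p as q pairs with m p, which lies in P_N, and the pairing is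
    nondegenerate. Backward: every q orthogonal to P_N pairs to zero with m, and P_N is its own
    double orthogonal. *)
Lemma m_s_in_PN :
  PN A B g v ms <-> star_img ms (orth (PN A B g v)) = [set 0]%classic.
Proof.
have charK := pchar_num K.
split=> [PNm|star0].
  apply/seteqP; split=> [_ [q qPN <-]|_ ->].
    apply: (dpair_nondegenerate charK) => p.
    rewrite dpairC dpair_diffop; apply: qPN.
    by rewrite mulrC; apply: ideal_genM.
  exists 0; last by rewrite linear0.
  by move=> p _; rewrite diffop0l meval0.
apply: (orth_orth charK); [exact: ideal_gen_subspace | exact: PN_homog |].
move=> q qPN; have : [set 0]%classic (diffop ms q) by rewrite -star0; exists q.
by rewrite dpairC /dpair => /= ->; rewrite meval0.
Qed.

Lemma star_orth_PN_eq :
    PN A B g v = mul_img ms (PB B g v) ->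
  star_img ms (orth (PN A B g v)) = orth (PB B g v).
Proof.
move=> PNE; apply/seteqP; split=> [|q qPB]; first exact: star_orth_PN.
(* A preimage of [q] under m(d) is orthogonal to P_N by adjointness, as every element of P_N is m
   times an element of P_B. *)
have [r rE] := diffop_surj (pchar_num K) q m_s_homog m_s_neq0.
exists r => //; rewrite PNE => _ [p PBp <-].
by rewrite -[LHS]/(dpair r _) -dpair_diffop rE; apply: qPB.
Qed.

End FakeExponent.

Theorem proposition3p11 (R : realType) (d n h M : nat)
    (A : 'M[int]_(d, n))
    (hrank : \rank (map_mx (intr : int -> rat) A) = d)
    (hhom : homogeneous_mx A)
    (beta : 'cV[R[i]]_d) (w : 'cV[R]_n)
    (hw : monomial_ideal (init_ideal w (toric_ideal R[i] A)))
    (v : 'cV[R[i]]_n) (hv : fake_exponent A beta w v)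
    (B : 'M[int]_(n, h))
    (hBL : forall k, lattice A (col k B))
    (hBfree : row_free (map_mx (intr : int -> rat) B)^T)
    (hBsupp : forall u, lattice A u ->
       Isupp v 0 \subset msuppB B :|: Isupp v u)
    (g : 'I_M -> 'cV[int]_n)
    (hgGB : reduced_GB w (toric_ideal R[i] A)
       (range (fun i => lattice_binomial R[i] (g i))))
    (hgin : forall i, init_ideal w (toric_ideal R[i] A) 'X_[pos_part (g i)]) :
  let m := m_s A B g v in
  let P_N := PN A B g v in
  let P_B := PB B g v in
  [/\ [/\ (star_img m (orth P_N) `<=` orth P_B)%classic,
          (orth P_B `<=` orth P_N)%classic &
          KN A B g v = Isupp v 0 -> orth P_N = orth P_B],
      P_N m <-> star_img m (orth P_N) = [set 0]%classic &
      P_N = mul_img m P_B -> star_img m (orth P_N) = orth P_B].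
Proof.
have [_ v_fake] := hv; split; first split.
- exact: star_orth_PN v_fake hBsupp hgGB.
- exact: orth_PB_sub_orth_PN v_fake hgGB.
- exact: orth_PN_eq_orth_PB v_fake hBsupp hgGB.
- exact: m_s_in_PN.
- exact: star_orth_PN_eq v_fake hBsupp hgGB.
Qed.
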